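(* Let $d\ge1$, let $x_0\neq x_1\in\mathbb{R}^d$ have the same Euclidean norm, let $n_0,\dots,n_{M-1}$ be i.i.d. $\mathcal{N}(0,I_{d\times d})$, and let $\hat{x}_0,\hat{x}_1$ be the output of the soft-assignment algorithm with templates $x_0,x_1$. Then, almost surely as $M\to\infty$, $\hat{x}_0\to 2\,\mathbb{E}\left[\frac{n}{1+\exp(\langle n,x_1-x_0\rangle)}\right]$ and $\hat{x}_1\to-2\,\mathbb{E}\left[\frac{n}{1+\exp(\langle n,x_1-x_0\rangle)}\right]$, where $n\sim\mathcal{N}(0,I_{d\times d})$.
   Context: Soft-assignment algorithm: $p_i^{(\ell)}=\frac{\exp(\langle n_i,x_\ell\rangle)}{\exp(\langle n_i,x_0\rangle)+\exp(\langle n_i,x_1\rangle)}$ for $\ell\in\{0,1\}$, and $\hat{x}_\ell=\frac{\sum_{i=0}^{M-1}p_i^{(\ell)}n_i}{\sum_{i=0}^{M-1}p_i^{(\ell)}}$. *)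

(* Defs.v *)
From HB Require Import structures.
From mathcomp Require Import all_boot all_order all_algebra.
From mathcomp Require Import all_classical all_reals all_analysis.
Set Implicit Arguments. Unset Strict Implicit. Unset Printing Implicit Defensive.
Import Order.TTheory GRing.Theory Num.Theory.
Local Open Scope classical_set_scope.
Local Open Scope ring_scope.

Definition dotp {R : realType} {d : nat} (u v : 'I_d -> R) : R :=
  \sum_(j < d) u j * v j.

Definition soft_p {R : realType} {d : nat} (x0 x1 : 'I_d -> R)
  (l : bool) (ni : 'I_d -> R) : R :=
  expR (dotp ni (if l then x1 else x0)) /
  (expR (dotp ni x0) + expR (dotp ni x1)).

Definition soft_xhat {R : realType} {d : nat} (x0 x1 : 'I_d -> R)
  (ns : nat -> 'I_d -> R) (l : bool) (M : nat) : 'I_d -> R :=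
  fun j => (\sum_(i < M) soft_p x0 x1 l (ns i) * ns i j) /
           (\sum_(i < M) soft_p x0 x1 l (ns i)).

Definition std_normal_rv {dT} {T : measurableType dT} {R : realType}
  (P : probability T R) (X : T -> R) : Prop :=
  measurable_fun setT X /\
  forall B : set R, measurable B -> P (X @^-1` B) = normal_prob 0 1 B.

Definition mutually_independent {dT} {T : measurableType dT} {R : realType}
  {I : eqType} (P : probability T R) (X : I -> T -> R) : Prop :=
  forall (s : seq I) (B : I -> set R), uniq s ->
    (forall i, i \in s -> measurable (B i)) ->
    P (\bigcap_(i in [set` s]) (X i @^-1` B i)) =
    (\prod_(i <- s) P (X i @^-1` B i))%E.

(* Main.v *)
From Stdlib Require PeanoNat.
Require Import Defs.
From HB Require Import structures.
From mathcomp Require Import all_boot all_order all_algebra.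
From mathcomp Require Import all_classical all_reals all_analysis measurable_realfun.
From mathcomp Require Import ring lra zify.
Import Order.TTheory GRing.Theory Num.Theory numFieldNormedType.Exports.
Local Open Scope classical_set_scope.
Local Open Scope ring_scope.

(** Writing [delta = x1 - x0], the weights are [soft_p false = sigmoid <n, delta>]
    and [soft_p true = sigmoid (- <n, delta>)] with [sigmoid x = 1 / (1 + exp x)].
    Dividing numerator and denominator of [soft_xhat] by [M], the strong law of
    large numbers reduces the claim to expectations. Since [-n] has the same law
    as [n] and [sigmoid (- x) = 1 - sigmoid x], the denominator tends to 1/2, and
    the numerators for [true] and [false] have opposite limits. The strong law is
    only needed for pairwise uncorrelated nonnegative variables with bounded
    variance: the means converge almost surely along the squares because their
    variances are summable there, and monotonicity of the partial sums
    fills the gaps. *)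

(** * Averages along the squares *)

Lemma cvg_sqrtn : Nat.sqrt n @[n --> \oo] --> \oo.
Proof.
apply/cvgnyPge => A; near=> n.
have /PeanoNat.Nat.sqrt_le_mono : (A * A <= n)%coq_nat.
  by apply/ssrnat.leP; near: n; exact: nbhs_infty_ge.
by rewrite PeanoNat.Nat.sqrt_square; lia.
Unshelve. all: by end_near. Qed.

(* With [k = sqrt n], the mean up to [n] lies between the means up to [k ^ 2] and
   [k.+1 ^ 2], up to the factor [(k / k.+1) ^ 2], which tends to 1. *)
Lemma cvg_mean_squares (R : realType) (x : nat -> R) (m : R) :
  (forall i, 0 <= x i) ->
  (\sum_(i < k ^ 2) x i) / (k ^ 2)%:R @[k --> \oo] --> m ->
  (\sum_(i < n) x i) / n%:R @[n --> \oo] --> m.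
Proof.
move=> x0 xm.
pose s (n : nat) := \sum_(i < n) x i.
have sS : {homo s : a b / (a <= b)%N >-> a <= b}.
  by apply: homo_leq => // [|n]; [exact: le_trans|rewrite /s big_ord_recr/= lerDl].
pose a k := s (k ^ 2)%N / (k ^ 2)%:R.
pose r (k : nat) : R := (k%:R / k.+1%:R) ^+ 2.
have r1 : r k @[k --> \oo] --> (1 : R).
  rewrite -[X in _ --> X](expr1n _ 2).
  have : (k%:R / k.+1%:R : R) @[k --> \oo] --> (1 : R).
    have -> : (fun k => k%:R / k.+1%:R : R) = (fun k => 1 - harmonic k).
      by apply/funext => k /=; rewrite -[k%:R](addrK 1) natr1 mulrBl divff ?mul1r//.
    rewrite -[X in _ --> X]subr0; apply: cvgB; [exact: cvg_cst|exact: cvg_harmonic].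
  by move=> h; apply: (cvg_comp _ (fun y : R => y ^+ 2) h); exact: exprn_continuous.
have a1 : a k.+1 @[k --> \oo] --> m by rewrite (cvg_shiftS a).
have lo : a k * r k @[k --> \oo] --> m.
  by rewrite -[X in _ --> X]mulr1; exact: cvgM.
have hi : a k.+1 * (r k)^-1 @[k --> \oo] --> m.
  rewrite -[X in _ --> X]mulr1; apply: cvgM => //.
  by rewrite -invr1; apply: cvgV.
apply: (@squeeze_cvgr _ _ _ _ (fun n => a (Nat.sqrt n) * r (Nat.sqrt n))
   (fun n => a (Nat.sqrt n).+1 * (r (Nat.sqrt n))^-1)); last 2 first.
- exact: (@cvg_comp _ _ _ Nat.sqrt (fun k => a k * r k) _ _ _ cvg_sqrtn lo).
- exact: (@cvg_comp _ _ _ Nat.sqrt (fun k => a k.+1 * (r k)^-1) _ _ _ cvg_sqrtn hi).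
near=> n.
have n0 : (0 < n)%N by near: n; exact: nbhs_infty_gt.
have [/ssrnat.leP l /ssrnat.ltP u] := PeanoNat.Nat.sqrt_spec n (PeanoNat.Nat.le_0_l n).
set k := Nat.sqrt n in l u *.
have k0 : (0 < k)%N by case: (k) u l; lia.
have s0 q : 0 <= s q by exact: sumr_ge0.
rewrite /a /r -!mulnn.
have kR : (k%:R : R) != 0 by rewrite pnatr_eq0 -lt0n.
have kR1 : (k.+1%:R : R) != 0 by [].
(* The factors [r k] and [(r k)^-1] exchange the denominators, so the two bounds become
   [s (k ^ 2) / (k.+1) ^ 2] and [s (k.+1 ^ 2) / k ^ 2], which enclose [s n / n] numerator by
   numerator and denominator by denominator. *)
have -> : s (k * k)%N / (k * k)%:R * (k%:R / k.+1%:R) ^+ 2 = s (k * k)%N / (k.+1 * k.+1)%:R.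
  by rewrite !natrM; field; rewrite nat1r kR1 kR.
have -> : s (k.+1 * k.+1)%N / (k.+1 * k.+1)%:R / (k%:R / k.+1%:R) ^+ 2 =
    s (k.+1 * k.+1)%N / (k * k)%:R.
  by rewrite !natrM; field; rewrite nat1r kR1 kR.
rewrite -/(s n).
have V p q : (0 < p <= q)%N -> (q%:R : R)^-1 <= p%:R^-1.
  by move=> /andP[p0 pq]; rewrite lef_pV2 ?ler_nat// posrE ltr0n// (leq_trans p0).
apply/andP; split; apply: ler_pM; rewrite ?invr_ge0//.
- exact: sS.
- by apply: V; rewrite n0 ltnW.
- by apply: sS; exact: ltnW.
- by apply: V; rewrite muln_gt0 k0.
Unshelve. all: by end_near. Qed.

(** * The Gaussian measure on the line: symmetry and second moment *)

(** Lebesgue measure is invariant under reflection and the centered density is even. *)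
Lemma normal_prob_oppr (R : realType) (s : R) (B : set R) : s != 0 -> measurable B ->
  normal_prob 0 s (-%R @^-1` B) = normal_prob 0 s B.
Proof.
move=> s0 mB; rewrite /normal_prob.
have pdfN (x : R) : normal_pdf 0 s (- x) = normal_pdf 0 s x.
  by rewrite normal_pdfE// /normal_fun !subr0 sqrrN.
transitivity (\int[pushforward lebesgue_measure
    (-%R : measurableTypeR R -> measurableTypeR R)]_(x in B) (normal_pdf 0 s x)%:E)%E; last first.
  by apply: eq_measure_integral => A mA _; exact: lebesgue_measureN.
rewrite ge0_integral_pushforward//=.
- by apply: eq_integral => x _ /=; rewrite pdfN.
- by apply/measurable_EFinP/measurable_funTS; exact: measurable_normal_pdf.
- by move=> x _; rewrite lee_fin normal_pdf_ge0.
Qed.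

(** The Radon-Nikodym derivative of the Gaussian measure and its explicit density have the same
    integral over every measurable set, so they agree almost everywhere and the change of variables
    may use the density. *)
Lemma ge0_integral_normal_prob (R : realType) (m s : R) (f : R -> \bar R) :
  measurable_fun setT f -> (forall x, 0 <= f x)%E ->
  (\int[normal_prob m s]_x f x =
   \int[lebesgue_measure]_x (f x * (normal_pdf m s x)%:E))%E.
Proof.
move=> mf f0; pose dom := @normal_prob_dominates R m s.
rewrite -(Radon_Nikodym_SigmaFinite.change_of_variables dom)//.
have mg := measurable_int _ (Radon_Nikodym_SigmaFinite.f_integrable dom).
have mp : measurable_fun setT (fun x : measurableTypeR R => (normal_pdf m s x)%:E).
  by apply/measurable_EFinP; exact: measurable_normal_pdf.
apply: ae_eq_integral => //.
- exact: emeasurable_funM.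
- exact: emeasurable_funM.
apply: ae_eqe_mul2l; apply: integral_ae_eq => //.
  exact: Radon_Nikodym_SigmaFinite.f_integrable.
by move=> E _ mE; rewrite -Radon_Nikodym_SigmaFinite.f_integral.
Qed.

Lemma normal_prob_sqr_lty (R : realType) :
  (\int[normal_prob 0 1]_x (x ^+ 2 : R)%:E < +oo)%E.
Proof.
rewrite ge0_integral_normal_prob; last 2 first.
- by apply/measurable_EFinP; exact: exprn_measurable.
- by move=> x; rewrite lee_fin sqr_ge0.
(* The integrand is compared with the density of variance 2, whose exponential is
   [exp (- x ^ 2 / 4)]: half of the original exponent is kept, the other half pays for
   [x ^ 2 <= 4 exp (x ^ 2 / 4)]. The constant [c] collects this 4 and the ratio of the normalizing
   factors. *)
pose s := Num.sqrt 2 : R.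
have s0 : s != 0 by rewrite gt_eqF// sqrtr_gt0.
pose c := 4 * normal_peak 1 / normal_peak s : R.
apply: (@le_lt_trans _ _ (\int[lebesgue_measure]_x (c%:E * (normal_pdf 0 s x)%:E))%E); last first.
  by rewrite integralZl//; [rewrite integral_normal_pdf mule1 ltry|exact: integrable_normal_pdf].
apply: ge0_le_integral => //.
- by move=> x _; rewrite mule_ge0// lee_fin ?sqr_ge0// normal_pdf_ge0.
- apply: emeasurable_funM; apply/measurable_EFinP; first exact: exprn_measurable.
  exact: measurable_normal_pdf.
- by apply: measurable_funeM; apply/measurable_EFinP; exact: measurable_normal_pdf.
move=> x _; rewrite -!EFinM lee_fin !normal_pdfE ?oner_neq0// /normal_fun !subr0.
have ps : normal_peak s != 0 by rewrite gt_eqF// normal_peak_gt0.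
rewrite /c sqr_sqrtr// expr1n.
rewrite [leRHS]mulrA divfK//.
rewrite mulrCA (mulrC 4) -[leRHS]mulrA ler_wpM2l ?normal_peak_ge0//.
have -> : - x ^+ 2 / (1 *+ 2) = - (x ^+ 2 / 4) + - x ^+ 2 / (2 *+ 2) by field.
rewrite expRD mulrA ler_wpM2r ?expR_ge0//.
(* [y <= exp y] at [y = x ^ 2 / 4] absorbs the polynomial factor. *)
rewrite expRN ler_pdivrMr ?expR_gt0//.
have := expR_ge1Dx (x ^+ 2 / 4); lra.
Qed.

(** * Measures on tuples and boxes *)

Section tuple_law.
Context (R : realType) (d : nat).
Local Notation V := (d.-tuple (measurableTypeR R)).

Definition box (B : 'I_d -> set R) : set V :=
  [set x | forall j, B j (tnth x j)].

Lemma measurable_box (B : 'I_d -> set R) :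
  (forall j, measurable (B j)) -> measurable (box B).
Proof.
move=> mB.
rewrite (_ : box B = \bigcap_(j in [set: 'I_d]) ((fun x : V => tnth x j) @^-1` B j)); last first.
  by apply/seteqP; split => x /= Bx j; [move=> _; exact: Bx|exact: Bx].
apply: fin_bigcap_measurable => // j _.
by rewrite -[X in measurable X]setTI; apply: (measurable_tnth j); [exact: measurableT|exact: mB].
Qed.

(** Boxes are stable under intersection and generate the product sigma-algebra, so finite measures
    agreeing on them are equal. *)
Lemma tuple_measure_unique (m1 m2 : {measure set V -> \bar R}) :
  (m1 setT < +oo)%E ->
  (forall B : 'I_d -> set R, (forall j, measurable (B j)) -> m1 (box B) = m2 (box B)) ->
  forall A, measurable A -> m1 A = m2 A.
Proof.
move=> m1oo m12 A mA.
pose G : set (set V) := [set box B | B in [set B | forall j, measurable (B j)]].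
apply: (measure_unique G (fun _ => setT)) => //.
- apply/seteqP; split.
    apply: sub_sigma_algebra2 => A'.
    rewrite -bigcup_seq => -[j _ [C mC <-]].
    (* A cylinder over coordinate [j] is the box with the whole line in every other coordinate. *)
    exists (fun k => if k == j then C else setT).
      by move=> k; case: ifP.
    rewrite setTI; apply/seteqP; split => x /= => [/(_ j)|Cx k]; first by rewrite eqxx.
    by case: ifPn => // /eqP ->.
  apply: smallest_sub; first exact: sigma_algebra_measurable.
  by move=> _ [B mB <-]; exact: measurable_box.
- move=> _ _ [B mB <-] [C mC <-]; exists (fun j => B j `&` C j).
    by move=> j; exact: measurableI.
  apply/seteqP; split => x /= => [h|[h1 h2] j]; last by split.
  by split => j; have [] := h j.
- by move=> _; exists (fun _ => setT) => //; apply/seteqP; split.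
- by apply/seteqP; split => // x _; exists 0%N.
- by move=> _ [B mB <-]; exact: m12.
Qed.

End tuple_law.

(** * Integrals under equal laws and under independence *)

Section same_law.
Context d d' (T : measurableType d) (V : measurableType d') (R : realType).
Variable P : probability T R.
Variables X Y : {mfun T >-> V}.
Hypothesis XY : forall A, measurable A -> P (X @^-1` A) = P (Y @^-1` A).

Lemma ge0_integral_same_law (f : V -> \bar R) : measurable_fun setT f ->
  (forall v, 0 <= f v)%E -> (\int[P]_t f (X t) = \int[P]_t f (Y t))%E.
Proof.
move=> mf f0; rewrite -!(@ge0_integral_distribution _ _ _ _ _ P _ f)//.
by apply: eq_measure_integral => A mA _; exact: XY.
Qed.

(** Positive and negative parts commute with composition, so the nonnegative case applies to each
    part. *)
Lemma integral_same_law (f : V -> \bar R) : measurable_fun setT f ->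
  (\int[P]_t f (X t) = \int[P]_t f (Y t))%E.
Proof.
move=> mf; rewrite [LHS]integralE [RHS]integralE.
have pE (Z : T -> V) : ((fun t => f (Z t))^\+ = (fun t => f^\+ (Z t)))%E.
  exact: (funepos_comp f Z).
have nE (Z : T -> V) : ((fun t => f (Z t))^\- = (fun t => f^\- (Z t)))%E.
  exact: (funeneg_comp f Z).
rewrite !pE !nE; congr (_ - _)%E; apply: ge0_integral_same_law => //.
  exact: measurable_funepos.
exact: measurable_funeneg.
Qed.

End same_law.
Arguments integral_same_law {d d' T V R P X Y} _ {f} _.

(** Independence says that the law of the pair agrees with the product of the laws on rectangles,
    hence everywhere; Tonelli then splits the integral. *)
Lemma ge0_integral_mul_indep d d' (T : measurableType d) (V : measurableType d') (R : realType)
    (P : probability T R) (X Y : {mfun T >-> V}) (f g : V -> \bar R) :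
  (forall A B, measurable A -> measurable B ->
    P (X @^-1` A `&` Y @^-1` B) = P (X @^-1` A) * P (Y @^-1` B))%E ->
  measurable_fun setT f -> (forall v, 0 <= f v)%E ->
  measurable_fun setT g -> (forall v, 0 <= g v)%E ->
  (\int[P]_t (f (X t) * g (Y t)) = \int[P]_t f (X t) * \int[P]_t g (Y t))%E.
Proof.
move=> XY mf f0 mg g0.
pose Z : T -> V * V := fun t => (X t, Y t).
have mZ : measurable_fun setT Z by exact/measurable_fun_pairP.
pose Zm : {mfun T >-> (V * V)%type} := HB.pack Z (isMeasurableFun.Build _ _ _ _ _ mZ).
pose h (z : V * V) := (f z.1 * g z.2)%E.
have mh : measurable_fun setT h.
  by apply: emeasurable_funM; apply: measurableT_comp.
have h0 z : (0 <= h z)%E by rewrite mule_ge0.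
transitivity (\int[distribution P Zm]_z h z)%E.
  by rewrite ge0_integral_distribution.
transitivity (\int[distribution P X \x distribution P Y]_z h z)%E.
  apply: eq_measure_integral => A mA _; apply/esym.
  by apply: product_measure_unique => // B C mB mC; rewrite -XY.
rewrite fubini_tonelli1//= /fubini_F /h /=.
under eq_integral do rewrite ge0_integralZl//.
rewrite ge0_integralZr//; last exact: integral_ge0.
by rewrite !ge0_integral_distribution.
Qed.

(** * Strong law for nonnegative uncorrelated variables *)

(** The real partial sums are nondecreasing and bounded by the finite extended sum, so the series
    converges and its terms vanish. *)
Lemma cvg_nneseries_cvg0 (R : realType) (u : nat -> R) : (forall k, 0 <= u k) ->
  (\sum_(k <oo) (u k)%:E < +oo)%E -> u k @[k --> \oo] --> (0 : R).
Proof.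
move=> u0 uoo; apply: cvg_series_cvg_0; apply: nondecreasing_is_cvgn.
  by apply: nondecreasing_series => k _ _; exact: u0.
have s0 : (0 <= \sum_(k <oo) (u k)%:E)%E by apply: nneseries_ge0 => k _ _; rewrite lee_fin.
exists (fine (\sum_(k <oo) (u k)%:E)) => _ [n _ <-].
rewrite -lee_fin fineK ?ge0_fin_numE// -sumEFin.
by apply: nneseries_lim_ge => k _ _; rewrite lee_fin.
Qed.

Lemma sum_inv_sqr_le (R : realType) n :
  \sum_(0 <= i < n) ((i.+1 ^ 2)%:R^-1 : R) <= 2.
Proof.
(* The sharper bound [2 - 1 / k.+1] makes the induction close, since
   [1 / (a + 1) ^ 2 <= 1 / a - 1 / (a + 1)]. *)
suff H k : \sum_(0 <= i < k.+1) ((i.+1 ^ 2)%:R^-1 : R) <= 2 - k.+1%:R^-1.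
  case: n => [|n]; first by rewrite big_geq.
  by apply: (le_trans (H n)); rewrite lerBlDr lerDl invr_ge0.
elim: k => [|k IH]; first by rewrite big_nat1 invr1; lra.
rewrite big_nat_recr//=; apply: (le_trans (lerD IH (lexx _))).
have a0 : (0 : R) < k.+1%:R by rewrite ltr0n.
rewrite natrX -[k.+2%:R]natr1.
move: (k.+1%:R : R) a0 => a a0.
rewrite -subr_ge0.
have -> : 2 - (a + 1)^-1 - (2 - a^-1 + ((a + 1) ^+ 2)^-1) = (a * (a + 1) ^+ 2)^-1.
  by field; rewrite !gt_eqF//; lra.
by rewrite invr_ge0 mulr_ge0 ?sqr_ge0// ltW.
Qed.

Section slln.
Context d (T : measurableType d) (R : realType) (P : probability T R).
Variables (X : nat -> T -> R) (m C : R).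
Hypothesis X2 : forall i, X i \in Lfun P 2%:E.
Hypothesis X0 : forall i t, 0 <= X i t.
Hypothesis Xm : forall i, ('E_P[X i] = m%:E)%E.
Hypothesis XC : forall i, ('V_P[X i] <= C%:E)%E.
Hypothesis Xcov : forall i k, i != k -> covariance P (X i) (X k) = 0%E.

Let S n : T -> R := fun t => \sum_(i < n) X i t.

Let S_recr n : S n.+1 = (S n \+ X n)%R.
Proof. by apply/funext => t; rewrite /S big_ord_recr. Qed.

Let S0 : S 0 = cst 0.
Proof. by apply/funext => t; rewrite /S big_ord0. Qed.

Let S2 n : S n \in Lfun P 2%:E.
Proof.
elim: n => [|n IH]; first by rewrite S0 Lfun_cst.
by rewrite S_recr rpredD// lee1n.
Qed.

Let Lfun21 (Y : T -> R) : Y \in Lfun P 2%:E -> Y \in Lfun P 1.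
Proof. by apply: Lfun_subset12; exact: fin_num_measure. Qed.

Let ES n : ('E_P[S n] = (n%:R * m)%:E)%E.
Proof.
elim: n => [|n IH]; first by rewrite S0 expectation_cst mul0r.
rewrite S_recr expectationD ?Lfun21//; rewrite IH Xm -EFinD.
by rewrite -natr1 mulrDl mul1r.
Qed.

Let covS n k : (n <= k)%N -> covariance P (S n) (X k) = 0%E.
Proof.
elim: n => [|n IH] nk; first by rewrite S0 covariance_cst_l.
by rewrite S_recr covarianceDl// IH ?(ltnW nk)// Xcov ?adde0// neq_ltn nk.
Qed.

Let VS n : ('V_P[S n] <= (n%:R * C)%:E)%E.
Proof.
elim: n => [|n IH]; first by rewrite S0 variance_cst mul0r.
rewrite S_recr varianceD// covS// mule0 adde0.
by rewrite -natr1 mulrDl mul1r EFinD leeD.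
Qed.

Let mX i : measurable_fun setT (X i).
Proof. by have := X2 i; rewrite inE => /andP[+ _]; rewrite inE. Qed.

Let mS n : measurable_fun setT (S n).
Proof. by apply: measurable_sum => i. Qed.

Let D n t : R := (S (n ^ 2) t / (n ^ 2)%:R - m) ^+ 2.

Let mD n : measurable_fun setT (D n).
Proof.
by apply: measurable_funX; apply: measurable_funB => //; apply: measurable_funM.
Qed.

(** With [N] terms of variance at most [C] and zero covariances, the mean has variance at most
    [N C / N ^ 2 = C / N]. The index [n.+1] keeps [N] nonzero. *)
Let ED n : (\int[P]_t (D n.+1 t)%:E <= (C / (n.+1 ^ 2)%:R)%:E)%E.
Proof.
set N := (n.+1 ^ 2)%N.
have N0 : (N%:R : R) != 0 by rewrite pnatr_eq0 expn_eq0.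
have -> : (fun t => (D n.+1 t)%:E) =
    (fun t => (N%:R^-1 ^+ 2)%:E *
      (((S N \- cst (fine 'E_P[S N]%E)) * (S N \- cst (fine 'E_P[S N]%E)))%R t)%:E)%E.
  apply/funext => t; rewrite ES/= -EFinM /D -/N !fctE; congr EFin => /=.
  by move: (N%:R : R) N0 (S N t) => a a0 b; field.
rewrite ge0_integralZl//; last 2 first.
- by apply/measurable_EFinP; apply: measurable_funM; apply: measurable_funB.
- by move=> t _; rewrite lee_fin -[_ t]/(_ t * _ t) -expr2 sqr_ge0.
have := VS N; rewrite /variance unlock unlock => h.
apply: (le_trans (lee_wpmul2l _ h)); first by rewrite lee_fin sqr_ge0.
by rewrite -EFinM lee_fin le_eqVlt; apply/orP; left; apply/eqP; field.
Qed.

(** The expected squared deviations along the squares are summable, so their sum [F] is integrable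
    and hence finite almost everywhere. Where it is finite the deviations tend to 0, and
    [cvg_mean_squares] extends the convergence to all indices. *)
Lemma slln_ge0_uncorrelated :
  {ae P, forall t, (\sum_(i < n) X i t) / n%:R @[n --> \oo] --> m}.
Proof.
pose F t := (\sum_(k <oo) (D k.+1 t)%:E)%E.
have D0 k t : (0 <= (D k t)%:E)%E by rewrite lee_fin sqr_ge0.
have mF : measurable_fun setT F.
  by apply: ge0_emeasurable_sum => // k _; apply/measurable_EFinP.
have F0 t : (0 <= F t)%E by apply: nneseries_ge0.
have IF : P.-integrable setT F.
  apply/integrableP; split => //.
  under eq_integral do rewrite gee0_abs//.
  rewrite integral_nneseries//; last by move=> k; apply/measurable_EFinP.
  apply: (@le_lt_trans _ _ (C * 2)%:E); last exact: ltry.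
  apply: lime_le.
    by apply: is_cvg_nneseries => k _ _; exact: integral_ge0.
  apply: nearW => n.
  apply: (@le_trans _ _ (\sum_(0 <= k < n) (C / (k.+1 ^ 2)%:R)%:E)%E).
    by apply: lee_sum => k _; exact: ED.
  rewrite sumEFin -mulr_sumr lee_fin ler_wpM2l ?sum_inv_sqr_le//.
  (* [C] is nonnegative because it bounds a variance. *)
  by rewrite -lee_fin; apply: le_trans (XC 0%N); exact: variance_ge0.
have := integrable_ae measurableT IF; apply: filterS => t /(_ I) Ft.
apply: (@cvg_mean_squares _ (fun i => X i t)) => [i|]; first exact: X0.
rewrite -(cvg_shiftS (fun k => (\sum_(i < k ^ 2) X i t) / (k ^ 2)%:R)).
apply/subr_cvg0; apply: norm_cvg0 => /=.
have Dt : D k.+1 t @[k --> \oo] --> 0.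
  apply: (@cvg_nneseries_cvg0 _ (fun k => D k.+1 t)) => [k|]; first exact: sqr_ge0.
  by move: Ft; rewrite ge0_fin_numE.
rewrite -[X in _ --> X]sqrtr0.
(* The absolute deviation is the square root of [D], and the square root is continuous at 0. *)
under eq_cvg do rewrite -sqrtr_sqr.
by apply: (cvg_comp _ _ Dt); exact: sqrt_continuous.
Qed.

End slln.

(** * Strong law for functions of i.i.d. random elements *)

Lemma Lfun2_of_sqr d (T : measurableType d) (R : realType)
    (P : probability T R) (Y : T -> R) : measurable_fun setT Y ->
  (\int[P]_t (Y t ^+ 2)%:E < +oo)%E -> Y \in Lfun P 2%:E.
Proof.
move=> mY Yoo; rewrite inE; apply/andP; split; rewrite inE//=.
rewrite /finite_norm unlock; apply: poweR_lty.
rewrite (eq_integral (fun t => (Y t ^+ 2)%:E))// => t _ /=.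
by congr EFin; rewrite powR_mulrn// real_normK ?num_real.
Qed.

Section iid_slln.
Context d d' (T : measurableType d) (V : measurableType d') (R : realType).
Variables (P : probability T R) (W : nat -> {mfun T >-> V}).
Hypothesis Wlaw : forall i A, measurable A -> P (W i @^-1` A) = P (W 0%N @^-1` A).
Hypothesis Windep : forall i k A B, i != k -> measurable A -> measurable B ->
  (P (W i @^-1` A `&` W k @^-1` B) = P (W i @^-1` A) * P (W k @^-1` B))%E.

(** Equal laws give a common mean and variance, and pairwise independence makes the covariances
    vanish, so the uncorrelated case applies. *)
Lemma iid_slln_ge0 (f : V -> R) : measurable_fun setT f -> (forall v, 0 <= f v) ->
  (\int[P]_t (f (W 0%N t) ^+ 2)%:E < +oo)%E ->
  {ae P, forall t, (\sum_(i < n) f (W i t)) / n%:R @[n --> \oo] -->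
                   fine (\int[P]_t (f (W 0%N t))%:E)%E}.
Proof.
move=> mf f0 foo.
have mfE : measurable_fun setT (EFin \o f) by exact/measurable_EFinP.
have Em i : (\int[P]_t (f (W i t))%:E = \int[P]_t (f (W 0%N t))%:E)%E.
  exact: (integral_same_law (Wlaw i) mfE).
have L2 i : (fun t => f (W i t)) \in Lfun P 2%:E.
  apply: Lfun2_of_sqr; first exact: measurableT_comp.
  rewrite (@integral_same_law _ _ _ _ _ _ _ _ (Wlaw i) (fun v => (f v ^+ 2)%:E))//.
  by apply/measurable_EFinP; exact: measurable_funX.
have L1 i : (fun t => f (W i t)) \in Lfun P 1.
  by apply: Lfun_subset12 (L2 i); exact: fin_num_measure.
have E0 i : ('E_P[fun t => f (W i t)] = (fine (\int[P]_t (f (W 0%N t))%:E))%:E)%E.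
  by have := expectation_fin_num (L1 i); rewrite unlock -(Em i) => /fineK ->.
apply: (@slln_ge0_uncorrelated _ _ _ P (fun i t => f (W i t)) _
    (fine 'V_P[fun t => f (W 0%N t)]%E)) => //= [i|i k ik].
- rewrite fineK ?variance_fin_num//.
  rewrite !varianceE// !E0 leeD2r//.
  rewrite unlock.
  by rewrite (@integral_same_law _ _ _ _ _ _ _ _ (Wlaw i) (fun v => (f v ^+ 2)%:E))//;
    apply/measurable_EFinP; exact: measurable_funX.
- rewrite covarianceE//; last exact: Lfun2_mul_Lfun1.
  have -> : ('E_P[(fun t => f (W i t)) * (fun t => f (W k t))]
      = 'E_P[fun t => f (W i t)] * 'E_P[fun t => f (W k t)])%E.
    rewrite unlock.
    have <- := @ge0_integral_mul_indep _ _ _ _ _ P (W i) (W k) (EFin \o f) (EFin \o f)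
      (fun A B => Windep i k A B ik) mfE (fun v => f0 v) mfE (fun v => f0 v).
    exact: eq_integral.
  by rewrite subee// !E0.
Qed.

(** The nonnegative case is applied to the positive and negative parts of [f], and the two limits
    are subtracted. *)
Lemma iid_slln (f : V -> R) : measurable_fun setT f ->
  (\int[P]_t (f (W 0%N t) ^+ 2)%:E < +oo)%E ->
  {ae P, forall t, (\sum_(i < n) f (W i t)) / n%:R @[n --> \oo] -->
                   fine (\int[P]_t (f (W 0%N t))%:E)%E}.
Proof.
move=> mf foo.
have mf2 : measurable_fun setT (fun t => (f (W 0%N t) ^+ 2)%:E).
  by apply/measurable_EFinP; apply: measurable_funX; exact: measurableT_comp.
(* Both parts of [f] lie between 0 and its absolute value, so they inherit its finite second
   moment. *)
have part (g : V -> R) : measurable_fun setT g -> (forall v, 0 <= g v <= `|f v|) ->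
    (\int[P]_t (g (W 0%N t) ^+ 2)%:E < +oo)%E.
  move=> mg gf; apply: le_lt_trans foo; apply: ge0_le_integral => //.
  - by move=> t _; rewrite lee_fin sqr_ge0.
  - by apply/measurable_EFinP; apply: measurable_funX; exact: measurableT_comp.
  move=> t _; have /andP[g0 gfW] := gf (W 0%N t).
  by rewrite lee_fin -[leRHS]real_normK ?num_real// ler_pXn2r ?nnegrE.
have mp : measurable_fun setT (f^\+) by exact: measurable_funrpos.
have mn : measurable_fun setT (f^\-) by exact: measurable_funrneg.
have fp v : 0 <= f^\+ v <= `|f v|.
  by rewrite funrpos_ge0 /funrpos /Num.max; case: ifP; rewrite ?normr_ge0 ?ler_norm.
have fn v : 0 <= f^\- v <= `|f v|.
  by rewrite funrneg_ge0 /funrneg /Num.max; case: ifP; rewrite ?normr_ge0// -normrN ler_norm.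
have Ip := iid_slln_ge0 _ mp (fun v => funrpos_ge0 f v) (part _ mp fp).
have In := iid_slln_ge0 _ mn (fun v => funrneg_ge0 f v) (part _ mn fn).
have L1 (g : V -> R) : measurable_fun setT g -> (forall v, 0 <= g v <= `|f v|) ->
    (fun t => g (W 0%N t)) \in Lfun P 1.
  move=> mg gf; apply: Lfun_subset12; first exact: fin_num_measure.
  by apply: Lfun2_of_sqr; [exact: measurableT_comp|exact: part].
have fE v : f v = f^\+ v - f^\- v by rewrite -[in LHS](funrposBneg f).
have Lp := L1 _ mp fp; have Ln := L1 _ mn fn.
have -> : fine (\int[P]_t (f (W 0%N t))%:E)%E =
    fine (\int[P]_t (f^\+ (W 0%N t))%:E)%E - fine (\int[P]_t (f^\- (W 0%N t))%:E)%E.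
  have := expectationB Lp Ln; have := expectation_fin_num Lp.
  have := expectation_fin_num Ln; rewrite unlock => Fn Fp E.
  rewrite -fineB// -E; congr fine; apply: eq_integral => t _.
  by rewrite fE.
apply: filterS2 Ip In => t /cvgB/[apply].
apply: cvg_trans; apply: near_eq_cvg; apply: nearW => n /=.
rewrite fctE -mulrBl -sumrB; congr (_ / _); apply: eq_bigr => i _.
by rewrite fE.
Qed.

End iid_slln.

(** * Law, symmetry and independence of the Gaussian vectors *)

Section gaussian_vectors.
Context (R : realType) (d : nat) (dT : measure_display) (T : measurableType dT).
Variables (P : probability T R) (n : nat -> T -> 'I_d -> R).
Hypothesis indep :
  mutually_independent P (fun ij : nat * 'I_d => fun t => n ij.1 t ij.2).
Hypothesis normal : forall i j, std_normal_rv P (fun t => n i t j).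
Local Notation V := (d.-tuple (measurableTypeR R)).

(* [c] is [1] or [-1]: the vector [n i] and its reflection. *)
Let vec_fun (c : R) i (t : T) : V := [tuple c * n i t j | j < d].

Let measurable_vec_fun c i : measurable_fun setT (vec_fun c i).
Proof.
apply/measurable_fun_tnthP => j.
rewrite (_ : _ \o _ = (fun t => c * n i t j)); last first.
  by apply/funext => t /=; rewrite tnth_mktuple.
by apply: measurable_funM => //; have [] := normal i j.
Qed.

Definition vec i : {mfun T >-> V} :=
  HB.pack (vec_fun 1 i) (isMeasurableFun.Build _ _ _ _ _ (measurable_vec_fun 1 i)).

Definition vecN i : {mfun T >-> V} :=
  HB.pack (vec_fun (-1) i) (isMeasurableFun.Build _ _ _ _ _ (measurable_vec_fun (-1) i)).

Lemma tnth_vec i t j : tnth (vec i t) j = n i t j.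
Proof. by rewrite tnth_mktuple mul1r. Qed.

Lemma tnth_vecN i t j : tnth (vecN i t) j = - n i t j.
Proof. by rewrite tnth_mktuple mulN1r. Qed.

Lemma probability_vec_box2 i k (B C : 'I_d -> set R) : i != k ->
  (forall j, measurable (B j)) -> (forall j, measurable (C j)) ->
  (P (vec i @^-1` box R d B `&` vec k @^-1` box R d C) =
   (\prod_(j < d) normal_prob 0 1 (B j)) * \prod_(j < d) normal_prob 0 1 (C j))%E.
Proof.
move=> ik mB mC.
(* The joint event constrains the [2 d] scalar variables indexed by [s]: row [i] through [B] and row
   [k] through [C]. Since [i != k] these indices are distinct, and independence of the coordinates
   factors the probability. *)
pose D (aj : nat * 'I_d) := if aj.1 == i then B aj.2 else C aj.2.
pose s := [seq (i, j) | j <- enum 'I_d] ++ [seq (k, j) | j <- enum 'I_d].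
have us : uniq s.
  have upair a : uniq [seq (a, j) | j <- enum 'I_d].
    by rewrite map_inj_uniq ?enum_uniq// => ? ? [].
  rewrite cat_uniq !upair andbT /=; apply/hasPn => _ /mapP[j _ ->]; apply/mapP => -[j' _ [ki _]].
  by rewrite ki eqxx in ik.
have mD aj : aj \in s -> measurable (D aj) by rewrite /D; case: ifP.
have := indep s D us mD.
have prod_slice a (F : nat * 'I_d -> \bar R) :
    (\prod_(aj <- [seq (a, j) | j <- enum 'I_d]) F aj = \prod_(j < d) F (a, j))%E.
  by rewrite big_map big_enum.
rewrite big_cat /= !prod_slice /=.
have DE a j : P ((fun t => n a t j) @^-1` D (a, j)) = normal_prob 0 1 (D (a, j)).
  by have [_ ->//] := normal a j; rewrite /D; case: ifP.
under eq_bigr do rewrite DE /D /= eqxx.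
under [X in (_ * X)%E]eq_bigr do rewrite DE /D /= eq_sym (negbTE ik).
move=> <-; congr (P _); apply/seteqP; split => t /=.
  move=> [tB tC] [a j] /=; rewrite mem_cat => /orP[|] /mapP[j' _ [-> ->]];
    rewrite /D /=.
    by rewrite eqxx -tnth_vec; exact: tB.
  by rewrite eq_sym (negbTE ik) -tnth_vec; exact: tC.
move=> tD; split => j.
  have := tD (i, j); rewrite /= /D /= eqxx tnth_vec; apply.
  by rewrite mem_cat map_f ?mem_enum.
have := tD (k, j); rewrite /= /D /= eq_sym (negbTE ik) tnth_vec; apply.
by rewrite mem_cat map_f ?mem_enum ?orbT.
Qed.

Lemma probability_vec_box i (B : 'I_d -> set R) : (forall j, measurable (B j)) ->
  (P (vec i @^-1` box R d B) = \prod_(j < d) normal_prob 0 1 (B j))%E.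
Proof.
move=> mB.
(* The second vector, at the different index [i.+1], is left unconstrained, so its product is 1. *)
have := @probability_vec_box2 i i.+1 B (fun=> setT) _ mB (fun=> measurableT).
rewrite (_ : box R d (fun=> setT) = setT); last by apply/seteqP; split.
rewrite preimage_setT setIT => ->; last by rewrite neq_ltn ltnSn.
by under [X in (_ * X)%E]eq_bigr do rewrite probability_setT; rewrite big1_eq mule1.
Qed.

(** The reflected vector lies in a box exactly when the vector lies in the reflected box, and each
    factor is symmetric. *)
Lemma probability_vecN_box i (B : 'I_d -> set R) : (forall j, measurable (B j)) ->
  P (vecN i @^-1` box R d B) = P (vec i @^-1` box R d B).
Proof.
move=> mB.
have -> : vecN i @^-1` box R d B = vec i @^-1` box R d (fun j => -%R @^-1` B j).
  by apply/seteqP; split => t /= h j; move: (h j); rewrite /= tnth_vecN tnth_vec.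
rewrite !probability_vec_box//; last first.
  by move=> j; rewrite -[X in measurable X]setTI; exact: (@oppr_measurable R setT).
by apply: eq_bigr => j _; rewrite normal_prob_oppr// oner_neq0.
Qed.

Let same_law_of_box (X Y : {mfun T >-> V}) :
  (forall B, (forall j, measurable (B j)) -> P (X @^-1` box R d B) = P (Y @^-1` box R d B)) ->
  forall A, measurable A -> P (X @^-1` A) = P (Y @^-1` A).
Proof.
move=> XY A mA.
apply: (@tuple_measure_unique R d (distribution P X) (distribution P Y)) => //.
apply: le_lt_trans (ltry 1).
by apply: (@probability_le1 _ _ _ (distribution P X)).
Qed.

Lemma vec_law i A : measurable A -> P (vec i @^-1` A) = P (vec 0%N @^-1` A).
Proof.
by move: A; apply: same_law_of_box => B mB; rewrite !probability_vec_box.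
Qed.

Lemma vecN_law i A : measurable A -> P (vecN i @^-1` A) = P (vec i @^-1` A).
Proof. by move: A; apply: same_law_of_box => B mB; exact: probability_vecN_box. Qed.

(** For fixed [D], both sides are finite measures in [A]: the restriction of [P] to [D] pushed
    forward by [X], and the law of [X] scaled by [P D]. Agreement on boxes therefore suffices. *)
Let indep_of_box (X : {mfun T >-> V}) (D : set T) : measurable D ->
  (forall B, (forall j, measurable (B j)) ->
    P (X @^-1` box R d B `&` D) = P (X @^-1` box R d B) * P D)%E ->
  forall A, measurable A -> (P (X @^-1` A `&` D) = P (X @^-1` A) * P D)%E.
Proof.
move=> mD XD A mA.
have PD0 : 0 <= fine (P D) by exact: fine_ge0.
have PD : (fine (P D))%:E = P D by rewrite fineK// fin_num_measure.
pose m1 : {measure set V -> \bar R} := pushforward (mrestr P mD) X.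
pose m2 : {measure set V -> \bar R} := mscale (NngNum PD0) (distribution P X).
have := @tuple_measure_unique R d (m1 (measurable_funPT X)) m2.
rewrite /m1 /m2 /= /pushforward /mrestr /mscale /= => H.
rewrite H//.
- by rewrite PD muleC.
- by rewrite preimage_setT setTI -ge0_fin_numE ?fin_num_measure.
- by move=> B mB; rewrite XD// PD muleC.
Qed.

(** The product formula on pairs of boxes is extended to measurable sets one factor at a time. *)
Lemma vec_indep i k A B : i != k -> measurable A -> measurable B ->
  (P (vec i @^-1` A `&` vec k @^-1` B) = P (vec i @^-1` A) * P (vec k @^-1` B))%E.
Proof.
move=> ik mA mB.
have mvec l E : measurable E -> measurable (vec l @^-1` E).
  by move=> mE; have := measurable_funPT (vec l) measurableT E mE; rewrite setTI.
move: A mA; apply: indep_of_box; first exact: mvec.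
move=> C mC; rewrite setIC muleC.
move: B mB; apply: indep_of_box; first by apply: mvec; exact: measurable_box.
move=> D mD; rewrite setIC probability_vec_box2// !probability_vec_box//.
by rewrite muleC.
Qed.

End gaussian_vectors.

(** * The weights as sigmoids *)

(** This is the decreasing version, the usual logistic function at [- x], chosen to match the
    denominator in the limit. *)
Definition sigmoid (R : realType) (x : R) : R := (1 + expR x)^-1.

Lemma sigmoidN (R : realType) (x : R) : sigmoid R (- x) = 1 - sigmoid R x.
Proof.
rewrite /sigmoid expRN.
have := expR_gt0 x; move: (expR x) => e e0.
by field; rewrite !gt_eqF//; lra.
Qed.

Lemma sigmoid_ge0 (R : realType) (x : R) : 0 <= sigmoid R x.
Proof. by rewrite invr_ge0 addr_ge0// expR_ge0. Qed.

Lemma sigmoid_le1 (R : realType) (x : R) : sigmoid R x <= 1.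
Proof. by rewrite -subr_ge0 -sigmoidN sigmoid_ge0. Qed.

Lemma measurable_sigmoid (R : realType) : measurable_fun setT (sigmoid R).
Proof.
apply: continuous_measurable_fun => x; apply: cvgV.
  by rewrite gt_eqF// ltr_wpDr// expR_ge0.
by apply: cvgD; [exact: cvg_cst|exact: continuous_expR].
Qed.

(** Dividing by the numerator leaves 1 plus the exponential of a difference of inner products; the
    sign [(-1) ^+ l] treats both templates at once. *)
Lemma soft_pE (R : realType) (d : nat) (x0 x1 : 'I_d -> R) (l : bool) (v : 'I_d -> R) :
  soft_p x0 x1 l v =
  sigmoid R (dotp v (fun k => (-1) ^+ l * (x1 k - x0 k))).
Proof.
have -> : dotp v (fun k => (-1) ^+ l * (x1 k - x0 k)) =
    (-1) ^+ l * (dotp v x1 - dotp v x0).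
  rewrite /dotp -sumrB mulr_sumr; apply: eq_bigr => j _.
  by rewrite mulrCA mulrBr.
rewrite /soft_p /sigmoid.
have a0 := expR_gt0 (dotp v x0); have b0 := expR_gt0 (dotp v x1).
case: l; rewrite ?expr1 ?mulN1r ?opprB ?expr0 ?mul1r expRD expRN;
  move: (expR _) (expR _) a0 b0 => a b a0 b0.
  by field; rewrite !gt_eqF//; lra.
by field; rewrite !gt_eqF//; lra.
Qed.

(** * Strong law and symmetry for the weighted sums *)

Section gaussian_slln.
Context (R : realType) (d : nat) (dT : measure_display) (T : measurableType dT).
Variables (P : probability T R) (n : nat -> T -> 'I_d -> R).
Hypothesis indep :
  mutually_independent P (fun ij : nat * 'I_d => fun t => n ij.1 t ij.2).
Hypothesis normal : forall i j, std_normal_rv P (fun t => n i t j).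
Local Notation V := (d.-tuple (measurableTypeR R)).
Let W := vec R d dT T P n normal.

Lemma std_normal_sqr_lty i j : (\int[P]_t (n i t j ^+ 2)%:E < +oo)%E.
Proof.
have [mX XE] := normal i j.
have mX' : measurable_fun setT ((fun t => n i t j) : T -> measurableTypeR R) by [].
pose X : {mfun T >-> measurableTypeR R} :=
  HB.pack (fun t => n i t j) (isMeasurableFun.Build _ _ _ _ _ mX').
have := normal_prob_sqr_lty R.
rewrite (eq_measure_integral (distribution P X)); last by move=> A mA _; apply/esym; exact: XE.
rewrite ge0_integral_distribution//.
  by apply/measurable_EFinP; exact: exprn_measurable.
by move=> y; rewrite lee_fin sqr_ge0.
Qed.

Let z (w : 'I_d -> R) (v : V) : R := dotp (fun j => tnth v j) w.

Let mz w : measurable_fun setT (z w).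
Proof.
apply: measurable_sum => j; apply: measurable_funM => //; exact: measurable_tnth.
Qed.

Let ms w : measurable_fun setT (fun v => sigmoid R (z w v)).
Proof. by apply: measurableT_comp; [exact: measurable_sigmoid|exact: mz]. Qed.

Let tnthW i t j : tnth (W i t) j = n i t j.
Proof. exact: tnth_vec. Qed.

Let WE i t : (fun k => tnth (W i t) k) = n i t.
Proof. by apply/funext => k; rewrite tnthW. Qed.

Let WN : {mfun T >-> V} := vecN R d dT T P n normal 0%N.

Let WNE t : (fun k => tnth (WN t) k) = (fun k => - n 0%N t k).
Proof. by apply/funext => k; rewrite tnth_vecN. Qed.

Let WN_law A : measurable A -> P (WN @^-1` A) = P (W 0%N @^-1` A).
Proof. exact: vecN_law. Qed.

Let dotpNr (u v : 'I_d -> R) : dotp u (fun k => - v k) = - dotp u v.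
Proof. by rewrite /dotp -sumrN; apply: eq_bigr => k _; rewrite mulrN. Qed.

Let dotpNl (u v : 'I_d -> R) : dotp (fun k => - u k) v = - dotp u v.
Proof. by rewrite /dotp -sumrN; apply: eq_bigr => k _; rewrite mulNr. Qed.

Let mWf (f : V -> R) : measurable_fun setT f ->
  measurable_fun setT (fun t => (f (W 0%N t) ^+ 2)%:E).
Proof.
by move=> mf; apply/measurable_EFinP; apply: measurable_funX; exact: measurableT_comp.
Qed.

Let sigmoid_sqr_lty w :
  (\int[P]_t (sigmoid R (z w (W 0%N t)) ^+ 2)%:E < +oo)%E.
Proof.
apply: (@le_lt_trans _ _ (\int[P]_t 1)%E).
  apply: ge0_le_integral => //.
  - by move=> t _; rewrite lee_fin sqr_ge0.
  - exact: (mWf _ (ms w)).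
  by move=> t _; rewrite lee_fin expr_le1 ?sigmoid_ge0 ?sigmoid_le1.
by rewrite integral_cst// mul1e -ge0_fin_numE ?fin_num_measure//.
Qed.

Let msj w j : measurable_fun setT (fun v : V => sigmoid R (z w v) * tnth v j).
Proof. by apply: measurable_funM => //; exact: measurable_tnth. Qed.

(** The weight is at most 1, so the square is dominated by that of a standard normal coordinate. *)
Let sigmoid_coord_sqr_lty w j :
  (\int[P]_t ((sigmoid R (z w (W 0%N t)) * tnth (W 0%N t) j) ^+ 2)%:E < +oo)%E.
Proof.
apply: le_lt_trans (std_normal_sqr_lty 0 j); apply: ge0_le_integral => //.
- by move=> t _; rewrite lee_fin sqr_ge0.
- exact: (mWf _ (msj w j)).
- by apply/measurable_EFinP; apply: measurable_funX; have [] := normal 0 j.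
move=> t _; rewrite lee_fin tnthW exprMn ler_piMl ?sqr_ge0//.
by rewrite expr_le1 ?sigmoid_ge0 ?sigmoid_le1.
Qed.

(** Reflecting the vector turns [sigmoid] into [1 - sigmoid] without changing the expectation [e],
    so [e = 1 - e]. *)
Lemma expectation_sigmoid (w : 'I_d -> R) :
  ('E_P[fun t => sigmoid R (dotp (n 0%N t) w)] = 2^-1%:E)%E.
Proof.
have mS : measurable_fun setT (fun v => (sigmoid R (z w v))%:E) by exact/measurable_EFinP.
have := integral_same_law WN_law mS.
rewrite /z; under eq_integral do rewrite WNE dotpNl sigmoidN.
under [in X in _ = X -> _]eq_integral do rewrite WE.
set X := fun t => sigmoid R (dotp (n 0%N t) w).
have X1 : X \in Lfun P 1.
  apply: Lfun_subset12; first exact: fin_num_measure.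
  have -> : X = (fun v => sigmoid R (z w v)) \o W 0%N.
    by apply/funext => t; rewrite /= /z WE.
  apply: Lfun2_of_sqr; first exact: measurableT_comp.
  exact: sigmoid_sqr_lty.
move=> law; have : ('E_P[(cst 1 \- X)%R] = 'E_P[X])%E by rewrite unlock; exact: law.
rewrite expectationB ?Lfun_cst// expectation_cst.
rewrite -(fineK (expectation_fin_num X1)) -EFinB => -[E].
congr EFin; lra.
Qed.

(** Replacing the vector by its reflection cancels the sign of [w] inside the sigmoid and moves it
    to the coordinate factor. *)
Lemma expectation_sigmoid_oppr (w : 'I_d -> R) j :
  ('E_P[fun t => (sigmoid R (dotp (n 0%N t) (fun k => - w k)) * n 0%N t j)%R] =
   - 'E_P[fun t => (sigmoid R (dotp (n 0%N t) w) * n 0%N t j)%R])%E.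
Proof.
pose w' k := - w k; pose Y t := sigmoid R (dotp (n 0%N t) w) * n 0%N t j.
have mf : measurable_fun setT (fun v => (sigmoid R (z w' v) * tnth v j)%:E).
  by apply/measurable_EFinP; exact: (msj w' j).
have Y1 : Y \in Lfun P 1.
  apply: Lfun_subset12; first exact: fin_num_measure.
  have -> : Y = (fun v => sigmoid R (z w v) * tnth v j) \o W 0%N.
    by apply/funext => t; rewrite /Y /= /z WE tnthW.
  apply: Lfun2_of_sqr; last exact: sigmoid_coord_sqr_lty.
  by apply: measurableT_comp => //; exact: msj.
transitivity ('E_P[(-1 \o* Y)%R])%E; last by rewrite expectationZl// EFinN mulN1e.
rewrite unlock; have := integral_same_law WN_law mf.
rewrite /z; under [in X in _ = X -> _]eq_integral do rewrite WE tnthW.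
move=> <-; apply: eq_integral => t _.
by rewrite WNE tnth_vecN dotpNr dotpNl opprK /= mulrN1 mulrN.
Qed.

Lemma slln_soft (w : 'I_d -> R) (j : 'I_d) :
  {ae P, forall t,
    (\sum_(i < M) sigmoid R (dotp (n i t) w)) / M%:R @[M --> \oo] --> (2^-1 : R) /\
    (\sum_(i < M) sigmoid R (dotp (n i t) w) * n i t j) / M%:R @[M --> \oo] -->
      fine ('E_P[fun t => (sigmoid R (dotp (n 0%N t) w) * n 0%N t j)%R])%E}.
Proof.
have slln := iid_slln _ _ _ _ _ P W (vec_law R d dT T P n indep normal)
  (vec_indep R d dT T P n indep normal).
have := slln _ (msj w j) (sigmoid_coord_sqr_lty w j).
have := slln _ (ms w) (sigmoid_sqr_lty w).
have E1 i t : sigmoid R (z w (W i t)) = sigmoid R (dotp (n i t) w) by rewrite /z WE.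
have Ej i t : sigmoid R (z w (W i t)) * tnth (W i t) j =
    sigmoid R (dotp (n i t) w) * n i t j by rewrite E1 tnthW.
apply: filterS2 => t h1 hj; split.
  have -> : 2^-1 = fine (\int[P]_t (sigmoid R (z w (W 0%N t)))%:E)%E.
    have := expectation_sigmoid w; rewrite unlock => E.
    by under eq_integral do rewrite E1; rewrite E.
  apply: cvg_trans h1; apply: near_eq_cvg; apply: nearW => M /=.
  by congr (_ / _); apply: eq_bigr => i _; rewrite E1.
have -> : ('E_P[fun t => (sigmoid R (dotp (n 0%N t) w) * n 0%N t j)%R] =
    \int[P]_t (sigmoid R (z w (W 0%N t)) * tnth (W 0%N t) j)%:E)%E.
  by rewrite unlock; under [RHS]eq_integral do rewrite Ej.
apply: cvg_trans hj; apply: near_eq_cvg; apply: nearW => M /=.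
by congr (_ / _); apply: eq_bigr => i _; rewrite Ej.
Qed.

End gaussian_slln.

(** * Limits of the soft-assignment averages *)

Theorem theorem3 (R : realType) (d : nat) (dT : measure_display)
  (T : measurableType dT) (P : probability T R)
  (x0 x1 : 'I_d -> R) (n : nat -> T -> 'I_d -> R) :
  (0 < d)%N ->
  x0 <> x1 ->
  dotp x0 x0 = dotp x1 x1 ->
  (* the coordinates (n i) j, i : nat, j : 'I_d, are independent N(0,1),
     i.e. n 0, n 1, ... are i.i.d. N(0, I_d) *)
  mutually_independent P (fun ij : nat * 'I_d => fun t => n ij.1 t ij.2) ->
  (forall i j, std_normal_rv P (fun t => n i t j)) ->
  let mu : 'I_d -> R := fun j =>
    fine ('E_P[fun t => n 0%N t j / (1 + expR (dotp (n 0%N t) (fun k => x1 k - x0 k)))]) in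
  {ae P, forall t, forall j : 'I_d,
     (fun M => soft_xhat x0 x1 (fun i => n i t) false M j) @ \oo --> 2 * mu j /\
     (fun M => soft_xhat x0 x1 (fun i => n i t) true M j) @ \oo --> - (2 * mu j)}.
Proof.
move=> _ _ _ indep normal mu.
(* [w l] is [x1 - x0] for [false] and its opposite for [true], so both weights are sigmoids of
   [<n, w l>]. *)
pose w (l : bool) k := (-1) ^+ l * (x1 k - x0 k).
pose m l j : R := fine ('E_P[fun t => (sigmoid R (dotp (n 0%N t) (w l)) * n 0%N t j)%R])%E.
have m_false j : m false j = mu j.
  rewrite /m /mu; congr (fine ('E_P[_])%E); apply/funext => t.
  by rewrite mulrC; congr (_ / (1 + expR _)); apply: eq_bigr => k _; rewrite /w mul1r.
have m_true j : m true j = - mu j.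
  rewrite -m_false -fineN /m -(expectation_sigmoid_oppr R d dT T P n indep normal).
  congr (fine ('E_P[_])%E); apply/funext => t; congr (sigmoid R _ * _).
  by apply: eq_bigr => k _; rewrite /w expr0 expr1 mul1r mulN1r.
have xhat_cvg l j : {ae P, forall t,
    soft_xhat x0 x1 (fun i => n i t) l M j @[M --> \oo] --> 2 * m l j}.
  have := slln_soft R d dT T P n indep normal (w l) j; apply: filterS => t [h1 hj].
  (* The limit [2 * m] is written as [m / (1 / 2)], the quotient of the limits of numerator and
     denominator means. *)
  rewrite mulrC -[2]invrK.
  have half0 : (2^-1 : R) != 0 by [].
  apply: cvg_trans (cvgM hj (cvgV half0 h1)).
  apply: near_eq_cvg; near=> M.
  (* For positive [M] the two normalizations by [M] cancel, leaving [soft_xhat]. *)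
  have M0 : (M%:R : R) != 0 by rewrite pnatr_eq0 -lt0n; near: M; exact: nbhs_infty_gt.
  rewrite /soft_xhat /=.
  have pE i : soft_p x0 x1 l (n i t) = sigmoid R (dotp (n i t) (w l)) by exact: soft_pE.
  under [in RHS]eq_bigr do rewrite pE.
  under [X in _ = _ / X]eq_bigr do rewrite pE.
  by rewrite -[LHS]/(_ / _) invf_div mulrA divfK.
(* There are finitely many coordinates, so the exceptional null sets can be united. *)
apply: filter_forall => j.
apply: filterS2 (xhat_cvg false j) (xhat_cvg true j) => t.
by rewrite m_false m_true mulrN.
Unshelve. all: by end_near. Qed.
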